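(* Let $0<q<1$, $\rho=e^{2\pi i/3}$, $x\in\mathbb{C}\setminus\{0\}$, and let $a\in\mathbb{C}\setminus\{0\}$ satisfy $a^3\ne q^{3k}$ for all $k\in\mathbb{Z}$. Then $$\sum_{n=-\infty}^\infty\frac{q^{9n^2}x^{3n}}{1-a^3q^{3n}}=\frac{(q^3;q^3)_\infty^2}{(q;q)_\infty^6}\,\frac{(a,q/a;q)_\infty^3}{(a^3,q^3a^{-3};q^3)_\infty}\sum_{j,k,\ell=-\infty}^\infty\frac{\rho^{k+2\ell}q^{(j+k+\ell)^2}x^{j+k+\ell}}{(1-aq^j)(1-aq^k)(1-aq^\ell)}.$$
   Context: Notation: $(c;q)_\infty=\prod_{j\ge0}(1-cq^j)$ and $(c_1,\dots,c_r;q)_\infty=\prod_i(c_i;q)_\infty$. *)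

(* Defs.v *)
From HB Require Import structures.
From mathcomp Require Import all_boot all_order all_algebra finmap complex.
From mathcomp Require Import all_classical all_reals all_analysis.
From mathcomp Require Import showcase.summability.

Set Implicit Arguments.
Unset Strict Implicit.
Unset Printing Implicit Defensive.
Import Order.TTheory GRing.Theory Num.Theory.
Import numFieldNormedType.Exports.

Local Open Scope classical_set_scope.
Local Open Scope ring_scope.
Local Open Scope complex_scope.

(* Packing R[i] as a numClosedFieldType makes it inherit the library's generic
   topology and norm of such a field, i.e. those of the complex modulus. *)
Definition Cplx (R : realType) : numClosedFieldType := R[i].

Section Definitions.
Context {R : realType}.
Local Notation C := (Cplx R).
Implicit Types (c q z : C).

Definition cexp z : C :=
  (expR (complex.Re z))%:C *
  (cos (complex.Im z) +i* sin (complex.Im z)).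

Definition rho : C := cexp (2 * pi%:C * 'i%C / 3).

Definition qpoch c q : C :=
  lim ((fun n : nat => \prod_(0 <= j < n) (1 - c * q ^+ j)) @ \oo).

Definition qpochs (cs : seq C) q : C := \prod_(c <- cs) qpoch c q.

(* Convergence of the net of finite partial sums; for complex terms this is the
   same as absolute convergence, and [sum f] is then the value of the series. *)
Definition unconditionally_summable (I : choiceType) (f : I -> C) : Prop :=
  cvg (partial_sum f @ totally).

End Definitions.

(* Main.v *)
Require Import Defs.
From HB Require Import structures.
From mathcomp Require Import all_boot all_order all_algebra finmap complex.
From mathcomp Require Import all_classical all_reals all_analysis.
From mathcomp Require Import showcase.summability.
From mathcomp Require cyclic separable cyclotomic.
From mathcomp Require Import ring lra zify.

(** Put [theta p c = (c, p/c; p)_oo].  Everything rests on Kronecker's formula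
<<
  sum_n z^n / (1 - a q^n) = (q;q)_oo^2 theta q (a z) / (theta q a * theta q z),
>>
valid for [q < |z| < 1] and used here only on the circle [|z| = r], where
[r^2 = q] ([kronecker]).  Multiply it at the three points [z], [rho z],
[rho^2 z].  The left-hand sides multiply to the triple series
[sum rho^(k+2l) z^(j+k+l) / ((1-aq^j)(1-aq^k)(1-aq^l))].  On the right, as
[(1-y)(1-rho y)(1-rho^2 y) = 1-y^3], the theta functions multiply in threes to
theta functions in base [q^3] at cubed arguments ([theta_cube]), and one
recognises Kronecker's formula for [q^3], [a^3], [z^3].  Hence
[sum_n z^(3n) / (1 - a^3 q^(3n))] is the stated constant times the triple
series, for every [z] on the circle.

Two Laurent series that agree on a circle have the same coefficients, so each
[z^N] may be replaced by [q^(N^2) x^N].  This is done without coefficient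
extraction ([weighted_sum_transfer]): a weight that is [O(r^N)] is a
pointwise limit, dominated by [r^N], of finite linear combinations of the
characters [N |-> z^N] with [|z| = r], because a function that is periodic up to
the factor [r^N] is such a combination by the finite Fourier transform
([circle_approximation]).

Kronecker's formula is itself a limit of a partial fraction decomposition.
The rational function [prod_i (1 - b z q^i) / (1 - b q^i)] of [b], with
[i < 2M+1], has explicit residues ([q_partial_fractions]); recentring by
[b = a q^(-M)] and letting [M] tend to infinity gives the formula, including
its constant.

All interchanges of limit and sum are instances of Tannery's theorem
([tannery]) for sums along the net of finite subsets. *)

Set Implicit Arguments.
Unset Strict Implicit.
Unset Printing Implicit Defensive.
Import Order.TTheory GRing.Theory Num.Theory.
Import numFieldNormedType.Exports.
Local Open Scope classical_set_scope.
Local Open Scope ring_scope.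
Local Open Scope complex_scope.

#[local] Existing Instance totally_filter.

(** * Absolutely summable families of complex numbers *)

Section Summation.
Context {R : realType}.
Local Notation C := (Cplx R).

Lemma gtc0_real (e : C) : 0 < e -> exists2 d : R, 0 < d & e = d%:C.
Proof.
case: e => u v; rewrite ltcE /= => /andP[/eqP -> u0]; by exists u.
Qed.

Lemma cvg_realC (T : Type) (F : set_system T) (FF : Filter F) (u : T -> R) (l : R) :
  u @ F --> l -> (fun t => (u t)%:C : C) @ F --> (l%:C : C).
Proof.
move=> /cvgrPdist_lt ul; apply/cvgrPdist_lt => e /gtc0_real[d d0 ->].
apply: filterS (ul d d0) => t; rewrite -rmorphB normc_def /= expr0n /= addr0 sqrtr_sqr.
by rewrite ltcR.
Qed.

Lemma sum_subseq_le (K : numDomainType) (T : eqType) (s t : seq T) (F : T -> K) :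
  uniq s -> uniq t -> {subset s <= t} -> (forall i, 0 <= F i) ->
  \sum_(i <- s) F i <= \sum_(i <- t) F i.
Proof.
move=> us ut st F0; rewrite [leRHS](bigID (mem s)) /= -[X in _ <= X + _]big_filter.
have -> : \sum_(i <- [seq i <- t | i \in s]) F i = \sum_(i <- s) F i.
  apply/perm_big/uniq_perm; rewrite ?filter_uniq// => i; rewrite mem_filter.
  by case: (boolP (i \in s)) => // /st.
by rewrite lerDl sumr_ge0.
Qed.

Lemma Re_sum (T : Type) (s : seq T) (F : T -> C) :
  complex.Re (\sum_(i <- s) F i) = \sum_(i <- s) complex.Re (F i).
Proof. by apply: (big_morph (@complex.Re R)) => // -[? ?] [? ?]. Qed.

Lemma Im_sum (T : Type) (s : seq T) (F : T -> C) :
  complex.Im (\sum_(i <- s) F i) = \sum_(i <- s) complex.Im (F i).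
Proof. by apply: (big_morph (@complex.Im R)) => // -[? ?] [? ?]. Qed.

Section Generic.
Variable I : choiceType.
Implicit Types (f g : I -> C) (J : {fset I}).

(** The bound lives in the complex numbers, whose order forces it to be real. *)
Definition abs_summable f : Prop :=
  exists M : C, forall J, \sum_(i <- J) `|f i| <= M.

Lemma partial_sumE (V : zmodType) (f : I -> V) J : partial_sum f J = \sum_(i <- J) f i.
Proof. by rewrite /partial_sum big_seq_fsetE. Qed.

Lemma fsum_split (V : zmodType) (f : I -> V) (J J' : {fset I}) : (J `<=` J')%fset ->
  \sum_(i <- J') f i = \sum_(i <- J) f i + \sum_(i <- J' | i \notin J) f i.
Proof.
move=> /fsubsetP JJ'; rewrite [LHS](bigID (mem J)) /= -[X in X + _ = _]big_filter.
congr (_ + _); apply/perm_big/uniq_perm; rewrite ?filter_uniq ?fset_uniq//.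
move=> i; rewrite mem_filter /=.
by case: (boolP (i \in J)) => // /JJ'.
Qed.

(** The net of partial sums is nondecreasing and bounded, hence tends to its supremum. *)
Lemma nonneg_sum_cvg (h : I -> R) (M : R) :
  (forall i, 0 <= h i) -> (forall J, \sum_(i <- J) h i <= M) ->
  cvg (partial_sum h @ totally).
Proof.
move=> h0 hM; pose S := [set \sum_(i <- J) h i | J in [set: {fset I}]].
have Sub : has_ubound S by exists M => _ [J _ <-].
have SS : has_sup S by split => //; exists (\sum_(i <- fset0) h i), fset0.
apply/cvg_ex; exists (sup S); apply/cvgrPdist_lt => e e0.
have [_ [J0 _ <-] J0e] := sup_adherent e0 SS.
exists J0 => // J /= J0J; rewrite partial_sumE.
have le_sup : \sum_(i <- J) h i <= sup S by apply: ub_le_sup => //; exists J.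
have le_J : \sum_(i <- J0) h i <= \sum_(i <- J) h i.
  by apply: sum_subseq_le => //; apply/fsubsetP.
rewrite ger0_norm ?subr_ge0//; lra.
Qed.

(** Adding [|f|] to the real and imaginary parts of [f] makes them nonnegative with
bounded partial sums. *)
Lemma abs_summable_cvg f : abs_summable f -> cvg (partial_sum f @ totally).
Proof.
move=> [M fM].
have nE (z : C) : complex.Re `|z| = Num.sqrt (complex.Re z ^+ 2 + complex.Im z ^+ 2).
  by rewrite normc_def.
have ReM J : \sum_(i <- J) complex.Re `|f i| <= complex.Re M.
  by have := fM J; rewrite lecE Re_sum => /andP[].
have part (h : I -> R) : (forall i, `|h i| <= complex.Re `|f i|) ->
    exists l : R, partial_sum h @ totally --> l.
  move=> hf.
  have h1 : cvg (partial_sum (fun i => h i + complex.Re `|f i|) @ totally).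
    apply: (@nonneg_sum_cvg _ (complex.Re M + complex.Re M)) => [i|J].
      by have := hf i; rewrite ler_norml; lra.
    rewrite big_split /= lerD// (le_trans _ (ReM J))// ler_sum// => i _.
    by have := hf i; rewrite ler_norml; lra.
  have h2 : cvg (partial_sum (fun i => complex.Re `|f i|) @ totally).
    apply: (@nonneg_sum_cvg _ (complex.Re M)) => // i.
    by rewrite nE sqrtr_ge0.
  exists (lim (partial_sum (fun i => h i + complex.Re `|f i|) @ totally) -
          lim (partial_sum (fun i => complex.Re `|f i|) @ totally)).
  apply: cvg_trans (cvgB h1 h2); apply: near_eq_cvg; near=> J.
  by rewrite ?fctE !partial_sumE big_split /= addrK.
have [u fu] : exists l : R, partial_sum (fun i => complex.Re (f i)) @ totally --> l.
  apply: part => i; rewrite nE -sqrtr_sqr ler_wsqrtr//.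
  by rewrite lerDl sqr_ge0.
have [v fv] : exists l : R, partial_sum (fun i => complex.Im (f i)) @ totally --> l.
  apply: part => i; rewrite nE -sqrtr_sqr ler_wsqrtr//.
  by rewrite lerDr sqr_ge0.
apply/cvg_ex; exists (u%:C + 'i%C * v%:C).
apply: cvg_trans (cvgD (cvg_realC _ fu) (cvgM (cvg_cst ('i%C : C)) (cvg_realC _ fv))); apply: near_eq_cvg; near=> J.
by rewrite ?fctE /= !partial_sumE -(Re_sum _ f) -(Im_sum _ f) -complexE.
Unshelve. all: by end_near.
Qed.

Lemma sum_unique f s : partial_sum f @ totally --> s -> sum f = s.
Proof. exact: (cvg_lim (@norm_hausdorff _ _)). Qed.

Lemma abs_summable_le g f : (forall i, `|f i| <= `|g i|) -> abs_summable g ->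
  abs_summable f.
Proof.
move=> fg [M gM]; exists M => J; apply: le_trans (gM J).
by apply: ler_sum => i _; exact: fg.
Qed.

Lemma abs_summable_norm f : abs_summable f -> abs_summable (fun i => `|f i|).
Proof. by apply: abs_summable_le => i; rewrite normr_id. Qed.

Lemma abs_summableZ c f : abs_summable f -> abs_summable (fun i => c * f i).
Proof.
move=> [M fM]; exists (`|c| * M) => J; under eq_bigr do rewrite normrM.
by rewrite -mulr_sumr ler_wpM2l.
Qed.

(** The convergent net [sum |g|] varies by less than [e] past some finite set. *)
Lemma abs_summable_tail g e : abs_summable g -> 0 < e ->
  exists J0, forall J, (J0 `<=` J)%fset -> \sum_(i <- J | i \notin J0) `|g i| < e.
Proof.
move=> /abs_summable_norm/abs_summable_cvg gs e0.
have /cvgrPdist_lt/(_ (e / 2)) := gs; rewrite divr_gt0// => /(_ isT)[J0 _ J0P].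
exists J0 => J J0J.
have := ltrD (J0P J J0J) (J0P J0 (fsubset_refl _)).
rewrite -splitr => /(le_lt_trans _); apply.
rewrite !partial_sumE distrC (fsum_split _ J0J); set S := lim _.
apply: le_trans (ler_normD _ _).
by rewrite addrA subrK [_ + \sum_(i <- J | _) _]addrC addrK ger0_norm ?sumr_ge0.
Qed.

(** The bound on the truncation error depends only on the dominating family [g]; this
uniformity is what Tannery's theorem needs. *)
Lemma sum_near f g e J0 : (forall i, `|f i| <= `|g i|) -> abs_summable g -> 0 < e ->
  (forall J, (J0 `<=` J)%fset -> \sum_(i <- J | i \notin J0) `|g i| < e) ->
  `|sum f - \sum_(i <- J0) f i| < e + e.
Proof.
move=> fg gs e0 tail.
have /cvgrPdist_lt/(_ e e0)[J1 _ J1P] := abs_summable_cvg (abs_summable_le fg gs).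
pose J := (J0 `|` J1)%fset.
have J0J : (J0 `<=` J)%fset by exact: fsubsetUl.
have := J1P J (fsubsetUr _ _); rewrite partial_sumE (fsum_split _ J0J) => fJ.
rewrite -[X in `|X|](subrK (\sum_(i <- J | i \notin J0) f i)) -[X in `|X + _|]addrA -opprD.
rewrite (le_lt_trans (ler_normD _ _))// ltrD//.
apply: le_lt_trans (tail J J0J); apply: le_trans (ler_norm_sum _ _ _) _.
by apply: ler_sum => i _; exact: fg.
Qed.

(** Dominated convergence for unordered sums: truncate to a finite set chosen from
the dominating family alone, where the limit can be taken termwise. *)
Lemma tannery (F : nat -> I -> C) f g :
  (forall n i, `|F n i| <= `|g i|) -> (forall i, `|f i| <= `|g i|) ->
  abs_summable g -> (forall i, F n i @[n --> \oo] --> f i) ->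
  sum (F n) @[n --> \oo] --> sum f.
Proof.
move=> Fg fg gs Ff; apply/cvgrPdist_lt => e e0.
(* Two truncation errors below [2e/5], and [e/5] for the finite sum. *)
have e5 : 0 < e / 5 by rewrite divr_gt0.
have [J0 tail] := abs_summable_tail gs e5.
have /cvgrPdist_lt/(_ _ e5) : \sum_(i <- J0) F n i @[n --> \oo] --> \sum_(i <- J0) f i.
  by apply: cvg_big => // ; exact: add_continuous.
apply: filterS => n Fn.
have h1 := sum_near fg gs e5 tail; have h2 := sum_near (Fg n) gs e5 tail.
rewrite distrC in h2.
have -> : sum f - sum (F n) = (sum f - \sum_(i <- J0) f i) +
  (\sum_(i <- J0) f i - \sum_(i <- J0) F n i) + (\sum_(i <- J0) F n i - sum (F n)) by ring.
apply: le_lt_trans (ler_normD _ _) _.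
apply: le_lt_trans (lerD (ler_normD _ _) (lexx _)) _.
apply: lt_le_trans (ltrD (ltrD h1 Fn) h2) _.
by rewrite le_eqVlt; apply/orP; left; apply/eqP; field.
Qed.

Lemma sum_lincomb (m : nat) (c : 'I_m -> C) (F : 'I_m -> I -> C) :
  (forall s, abs_summable (F s)) ->
  sum (fun i => \sum_s c s * F s i) = \sum_s c s * sum (F s).
Proof.
move=> Fs; apply: sum_unique.
have h : \sum_s c s * partial_sum (F s) J @[J --> totally] --> \sum_s c s * sum (F s).
  apply: cvg_big => [|s _]; first exact: add_continuous.
  apply: cvgM; [exact: cvg_cst | exact: abs_summable_cvg].
apply: cvg_trans h; apply: near_eq_cvg; near=> J.
under eq_bigr do rewrite partial_sumE mulr_sumr.
by rewrite partial_sumE exchange_big.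
Unshelve. all: by end_near.
Qed.

Lemma sumZ c f : abs_summable f -> sum (fun i => c * f i) = c * sum f.
Proof.
move=> fs; apply: sum_unique.
apply: cvg_trans (cvgM (cvg_cst c) (abs_summable_cvg fs)); apply: near_eq_cvg; near=> J.
by rewrite /= !partial_sumE mulr_sumr.
Unshelve. all: by end_near.
Qed.

Lemma sum_finite_support f J0 : (forall i, i \notin J0 -> f i = 0) ->
  sum f = \sum_(i <- J0) f i.
Proof.
move=> f0; apply: sum_unique; apply: cvg_near_cst; exists J0 => // J /= J0J.
by rewrite partial_sumE (fsum_split _ J0J) [X in _ + X]big1 ?addr0.
Qed.

Lemma exhaustion_cvg (E : nat -> {fset I}) f :
  (forall J, \forall n \near \oo, (J `<=` E n)%fset) -> abs_summable f ->
  \sum_(i <- E n) f i @[n --> \oo] --> sum f.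
Proof.
move=> EP fs; apply: (@cvg_trans _ (partial_sum f (E n) @[n --> \oo])).
  by apply: near_eq_cvg; near=> n; rewrite partial_sumE.
apply: (@cvg_comp _ _ _ E (partial_sum f) _ totally); last exact: abs_summable_cvg.
by move=> A [J _ JA]; apply: filterS (EP J) => n /JA.
Unshelve. all: by end_near.
Qed.

End Generic.

Lemma abs_summable_prod (I J : choiceType) (f : I -> C) (g : J -> C) :
  abs_summable f -> abs_summable g -> abs_summable (fun p : I * J => f p.1 * g p.2).
Proof.
move=> [M fM] [N gN]; exists (M * N) => A.
have M0 : 0 <= M by have := fM fset0; rewrite big_seq_fset0.
pose A1 := (fst @` A)%fset; pose A2 := (snd @` A)%fset.
apply: (@le_trans _ _ (\sum_(p <- [seq (i, j) | i <- A1, j <- A2]) `|f p.1 * g p.2|)).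
  apply: sum_subseq_le => //; first by rewrite allpairs_uniq ?fset_uniq// => -[? ?] [? ?].
  move=> p pA; apply/allpairsP; exists p; split; rewrite -?surjective_pairing//;
  by apply/imfsetP; exists p.
have -> : \sum_(p <- [seq (i, j) | i <- A1, j <- A2]) `|f p.1 * g p.2| =
    (\sum_(i <- A1) `|f i|) * (\sum_(j <- A2) `|g j|).
  rewrite big_allpairs mulr_suml; apply: eq_bigr => i _.
  by rewrite mulr_sumr; apply: eq_bigr => j _; rewrite normrM.
by rewrite ler_pM// sumr_ge0.
Qed.

(** Both sides are the limit of the sums over finite boxes [A x B], along the product
of the two nets of finite sets. *)
Lemma sum_prod (I J : choiceType) (f : I -> C) (g : J -> C) :
  abs_summable f -> abs_summable g ->
  sum (fun p : I * J => f p.1 * g p.2) = sum f * sum g.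
Proof.
move=> fs gs; have fgs := abs_summable_prod fs gs.
pose box (AB : {fset I} * {fset J}) := (AB.1 `*` AB.2)%fset.
have boxT : box @ filter_prod totally totally --> totally.
  move=> P [A _ AP]; exists ([set B | (fst @` A `<=` B)%fset], [set B | (snd @` A `<=` B)%fset]).
    by split => /=; [exists (fst @` A)%fset | exists (snd @` A)%fset].
  move=> [B1 B2] /= [/fsubsetP h1 /fsubsetP h2]; apply: AP => /=.
  apply/fsubsetP => p pA; rewrite in_fsetM h1 ?h2//; by apply/imfsetP; exists p.
have h1 : (partial_sum (fun p : I * J => f p.1 * g p.2) \o box) @
    filter_prod totally totally --> sum (fun p : I * J => f p.1 * g p.2).
  exact: cvg_comp boxT (abs_summable_cvg fgs).
have h2 : ((partial_sum f \o fst) \* (partial_sum g \o snd)) @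
    filter_prod totally totally --> sum f * sum g.
  apply: cvgM.
    exact: cvg_comp (@cvg_fst _ _ totally totally _) (abs_summable_cvg fs).
  exact: cvg_comp (@cvg_snd _ _ totally totally _) (abs_summable_cvg gs).
have E : partial_sum (fun p : I * J => f p.1 * g p.2) \o box =
  (partial_sum f \o fst) \* (partial_sum g \o snd).
  apply/funext => -[A B] /=; rewrite !partial_sumE /box /=.
  have -> : \sum_(p <- (A `*` B)%fset) f p.1 * g p.2 =
    \sum_(p <- [seq (i, j) | i <- A, j <- B]) f p.1 * g p.2.
    apply/perm_big/uniq_perm; rewrite ?fset_uniq//.
      by rewrite allpairs_uniq ?fset_uniq// => -[? ?] [? ?].
    move=> [i j]; rewrite in_fsetM /=; apply/idP/allpairsP.
      by move=> /andP[? ?]; exists (i, j).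
    by move=> [[? ?] /= [? ? [-> ->]]]; apply/andP.
  rewrite big_allpairs mulr_suml; apply: eq_bigr => i _.
  by rewrite mulr_sumr.
have FF : ProperFilter (filter_prod (@totally I) (@totally J)) by exact: filter_prod_proper.
rewrite E in h1.
exact: (cvg_unique (@norm_hausdorff C C) h1 h2).
Qed.
End Summation.

(** * Convergence and non-vanishing of q-Pochhammer products *)

Section Pochhammer.
Context {R : realType}.
Local Notation C := (Cplx R).

Lemma geometric_sum_le (r : C) (s : seq nat) : 0 <= r < 1 -> uniq s ->
  \sum_(k <- s) r ^+ k <= (1 - r)^-1.
Proof.
move=> /andP[r0 r1] us; pose m := (\max_(k <- s) k).+1.
apply: (@le_trans _ _ (\sum_(k <- iota 0 m) r ^+ k)).
  apply: sum_subseq_le; rewrite ?iota_uniq//; last by move=> k; exact: exprn_ge0.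
  move=> k ks.
  by rewrite mem_iota /= add0n ltnS; apply: (@leq_bigmax_seq _ _ xpredT (fun k => k)).
rewrite -[iota 0 m]/(index_iota 0 m) big_mkord -[leRHS]mul1r ler_pdivlMr ?subr_gt0//.
rewrite mulrC -opprB mulNr -subrX1 opprB lerBlDr lerDl; exact: exprn_ge0.
Qed.

Lemma abs_summable_geom_nat (r : C) : 0 <= r < 1 ->
  abs_summable (fun n : nat => r ^+ n).
Proof.
move=> r01; exists (1 - r)^-1 => J; apply: le_trans (geometric_sum_le r01 (fset_uniq J)).
apply: ler_sum => i _; rewrite ger0_norm//; apply: exprn_ge0; by case/andP: r01.
Qed.

Lemma abs_summable_geom_int (r : C) : 0 <= r < 1 ->
  abs_summable (fun n : int => r ^+ `|n|).
Proof.
move=> r01; have r0 : 0 <= r by case/andP: r01.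
exists ((1 - r)^-1 + (1 - r)^-1) => J.
rewrite (bigID (fun n : int => 0 <= n)) /=; apply: lerD.
  rewrite -big_filter; under eq_bigr do rewrite ger0_norm ?exprn_ge0//.
  rewrite -(big_map absz predT (fun k => r ^+ k)); apply: geometric_sum_le => //.
  rewrite map_inj_in_uniq ?filter_uniq ?fset_uniq// => x y.
  rewrite !mem_filter => /andP[? _] /andP[? _]; lia.
rewrite -big_filter; under eq_bigr do rewrite ger0_norm ?exprn_ge0//.
rewrite -(big_map absz predT (fun k => r ^+ k)); apply: geometric_sum_le => //.
rewrite map_inj_in_uniq ?filter_uniq ?fset_uniq// => x y.
rewrite !mem_filter => /andP[? _] /andP[? _]; lia.
Qed.

Lemma nat_series_cvg (f : nat -> C) : abs_summable f ->
  \sum_(0 <= j < n) f j @[n --> \oo] --> sum f.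
Proof.
move=> fs; pose E (n : nat) := [fset j in iota 0 n]%fset.
have h : \sum_(j <- E n) f j @[n --> \oo] --> sum f.
  apply: exhaustion_cvg => // J; exists (\max_(k <- J) k).+1 => // n /= Jn.
  apply/fsubsetP => k kJ; rewrite !inE mem_iota /= add0n; apply: leq_trans Jn.
  by rewrite ltnS; apply: (@leq_bigmax_seq _ _ xpredT (fun k => k)).
apply: cvg_trans h; apply: near_eq_cvg; near=> n.
apply/perm_big/uniq_perm; rewrite ?fset_uniq ?iota_uniq// => k.
by rewrite !inE mem_index_iota mem_iota.
Unshelve. all: by end_near.
Qed.

(** With [S_n] the partial sums of [|x_j|], the bound [|P_n - 1| <= 2 S_n <= 1] gives
[|P_n| <= 2], hence [|P_(n+1) - P_n| <= 2 |x_n|]. *)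
Lemma prod_near_one (x : nat -> C) n : \sum_(0 <= j < n) `|x j| <= 2^-1 ->
  `|\prod_(0 <= j < n) (1 - x j) - 1| <= 2 * \sum_(0 <= j < n) `|x j|.
Proof.
elim: n => [|n IH]; first by rewrite !big_geq// subrr normr0 mulr0.
rewrite !big_nat_recr//=; set P := \prod_(_ <= _ < _) _; set S := \sum_(_ <= _ < _) _ => Sx.
have S2 : S <= 2^-1 by apply: le_trans Sx; rewrite lerDl.
have {}IH := IH S2.
have P2 : `|P| <= 2.
  rewrite -[P](subrK 1); apply: le_trans (ler_normD _ _) _.
  rewrite normr1 -[leRHS]/(1 + 1 : C) lerD2r; apply: le_trans IH _.
  by rewrite mulrC -ler_pdivlMr// mul1r.
have -> : P * (1 - x n) - 1 = (P - 1) - P * x n by ring.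
apply: le_trans (ler_normB _ _) _; rewrite mulrDr lerD// normrM.
by rewrite ler_wpM2r.
Qed.

Variable q0 : R.
Hypothesis q01 : 0 < q0 < 1.
Let q : C := q0%:C.

(** The partial products of [qpoch c q]. *)
Definition qprod (c : C) n : C := \prod_(0 <= j < n) (1 - c * q ^+ j).

Lemma q_gt0 : 0 < q. Proof. by rewrite ltcR; case/andP: q01. Qed.
Lemma q_lt1 : q < 1. Proof. by rewrite (ltcR q0 1); case/andP: q01. Qed.
Lemma q_ge0lt1 : 0 <= q < 1. Proof. by rewrite ltW ?q_gt0 ?q_lt1. Qed.

Lemma qprodD c m n : qprod c (m + n) = qprod c m * qprod (c * q ^+ m) n.
Proof.
rewrite /qprod (@big_cat_nat _ _ _ m)//= ?leq_addr//; congr (_ * _).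
rewrite -{1}[m]add0n big_addn addKn; apply: eq_big_nat => j _.
by rewrite exprD mulrA [_ * q ^+ j * _]mulrAC.
Qed.

Lemma q_exp_cvg0 : (fun n => q ^+ n) @ \oo --> (0 : C).
Proof.
have h : (fun n : nat => (q0 ^+ n)%:C : C) @ \oo --> ((0 : R)%:C : C).
  by apply: cvg_realC; apply: cvg_expr; rewrite gtr0_norm; case/andP: q01.
by apply: cvg_trans h; apply: near_eq_cvg; near=> n; rewrite rmorphXn.
Unshelve. all: by end_near.
Qed.

Lemma qprod_tail_small c e : 0 < e -> exists m : nat, `|c * q ^+ m| <= e.
Proof.
move=> e0.
have ce : 0 < e / (1 + `|c|) by rewrite divr_gt0// ltr_wpDr.
have /cvgrPdist_lt/(_ _ ce)[m _ /(_ m (leqnn _))/=] := q_exp_cvg0.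
rewrite sub0r normrN => /ltW qme; exists m.
rewrite normrM mulrC; apply: (@le_trans _ _ (`|q ^+ m| * (1 + `|c|))).
  by rewrite ler_wpM2l// lerDr.
by rewrite -ler_pdivlMr// ltr_wpDr.
Qed.

Lemma qprod_sum_small c n : `|c| <= (1 - q) / 4 -> \sum_(0 <= j < n) `|c * q ^+ j| <= 4^-1.
Proof.
move=> cq; under eq_bigr do rewrite normrM.
rewrite -mulr_sumr; have := geometric_sum_le q_ge0lt1 (iota_uniq 0 n).
rewrite -{1}[n]subn0 -/(index_iota 0 n) => h.
have -> : \sum_(0 <= j < n) `|q ^+ j| = \sum_(0 <= j < n) q ^+ j.
  by apply: eq_bigr => j _; rewrite ger0_norm// exprn_ge0// ltW// q_gt0.
apply: le_trans (ler_pM _ _ cq h) _ => //.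
  by rewrite sumr_ge0// => j _; rewrite exprn_ge0// ltW// q_gt0.
by rewrite mulrAC mulfV ?mul1r// gt_eqF// subr_gt0 q_lt1.
Qed.

Lemma qprod_small c n : `|c| <= (1 - q) / 4 -> `|qprod c n - 1| <= 2^-1.
Proof.
move=> /(qprod_sum_small n) h.
have h2 : (4^-1 : C) <= 2^-1 by rewrite lef_pV2 ?posrE// ler_nat.
apply: le_trans (prod_near_one (le_trans h h2)) _.
apply: le_trans (ler_wpM2l _ h) _ => //.
by rewrite le_eqVlt; apply/orP; left; apply/eqP; field.
Qed.

(** The increments [- P_j c q^j] of the partial products are absolutely summable,
since the [P_j] are bounded. *)
Lemma qprod_small_cvg c : `|c| <= (1 - q) / 4 -> cvg (qprod c n @[n --> \oo]).
Proof.
move=> cq; pose f j := qprod c j * (c * q ^+ j).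
have fs : abs_summable f.
  apply: abs_summable_le (abs_summableZ (2 * c) (abs_summable_geom_nat q_ge0lt1)) => j.
  rewrite /f -mulrA !normrM ler_wpM2r ?mulr_ge0// normr_nat.
  rewrite -[qprod _ _](subrK 1); apply: le_trans (ler_normD _ _) _.
  rewrite normr1 -[leRHS]/(1 + 1 : C) lerD2r; apply: le_trans (qprod_small j cq) _.
  by rewrite invf_le1// ler1n.
apply/cvg_ex; exists (1 - sum f).
apply: cvg_trans (cvgB (cvg_cst (1 : C)) (nat_series_cvg fs)).
apply: near_eq_cvg; near=> n; rewrite /= ?fctE /=.
elim: (n) => [|k IH]; first by rewrite /qprod !big_geq// subr0.
rewrite /qprod !big_nat_recr//= -/(qprod c k) -IH /f -IH; ring.
Unshelve. all: by end_near.
Qed.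

(** Only the tail of the product matters, and it starts from an arbitrarily small
parameter [c q^m]. *)
Lemma qprod_cvg c : qprod c n @[n --> \oo] --> qpoch c q.
Proof.
suff : cvg (qprod c n @[n --> \oo]) by [].
have e0 : 0 < (1 - q) / 4 by rewrite divr_gt0// subr_gt0 q_lt1.
have [m cm] := qprod_tail_small c e0.
apply/cvg_ex; exists (qprod c m * lim (qprod (c * q ^+ m) n @[n --> \oo])).
rewrite -(cvg_shiftn m).
apply: cvg_trans (cvgM (cvg_cst _) (qprod_small_cvg cm)).
by apply: near_eq_cvg; near=> n; rewrite /= addnC qprodD.
Unshelve. all: by end_near.
Qed.

Lemma qprod_neq0 c n : (forall j : nat, c * q ^+ j != 1) -> qprod c n != 0.
Proof.
by move=> c1; rewrite /qprod big_mkord; apply/prodf_neq0 => j _; rewrite subr_eq0 eq_sym.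
Qed.

(** The finite head has no zero factor, and the partial products of the tail stay
within 1/2 of 1. *)
Lemma qpoch_neq0 c : (forall j : nat, c * q ^+ j != 1) -> qpoch c q != 0.
Proof.
move=> c1.
have e0 : 0 < (1 - q) / 4 by rewrite divr_gt0// subr_gt0 q_lt1.
have [m cm] := qprod_tail_small c e0.
have h := @qprod_cvg c; rewrite -(cvg_shiftn m) in h.
have h' : qprod c m * qprod (c * q ^+ m) n @[n --> \oo] --> qprod c m * qpoch (c * q ^+ m) q.
  by apply: cvgM; [exact: cvg_cst|exact: qprod_cvg].
have -> : qpoch c q = qprod c m * qpoch (c * q ^+ m) q.
  apply: (cvg_unique (@norm_hausdorff C C) h).
  apply: cvg_trans h'; apply: near_eq_cvg; near=> n; by rewrite /= addnC qprodD.
rewrite mulf_neq0//; first exact: qprod_neq0.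
apply/eqP => l0; have := @qprod_cvg (c * q ^+ m); rewrite l0 => /cvgrPdist_lt.
move=> /(_ 2^-1); rewrite invr_gt0 ltr0n => /(_ isT)[k _ /(_ k (leqnn _))/=].
rewrite sub0r normrN => lt2; have le2 := qprod_small k cm.
suff : (1 : C) < 1 by rewrite ltxx.
have {1}<- : `|qprod (c * q ^+ m) k - (qprod (c * q ^+ m) k - 1)| = 1 :> C.
  by rewrite opprB addrC subrK normr1.
apply: le_lt_trans (ler_normB _ _) _; apply: lt_le_trans (ltr_leD lt2 le2) _.
by rewrite le_eqVlt; apply/orP; left; apply/eqP; field.
Unshelve. all: by end_near.
Qed.

Lemma cvg_bounded (u : nat -> C) (l : C) : u @ \oo --> l -> exists B : C, forall n, `|u n| <= B.
Proof.
move=> /cvgrPdist_lt/(_ 1 ltr01)[m _ mP].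
exists (`|l| + 1 + \sum_(0 <= j < m) `|u j|) => n.
case: (ltnP n m) => nm; last first.
  apply: (@le_trans _ _ (`|l| + 1)); last by rewrite lerDl sumr_ge0.
  have /= := mP n nm; rewrite distrC => /ltW ul.
  rewrite -[u n](subrK l) addrC; apply: le_trans (ler_normD _ _) _.
  by rewrite lerD2l.
apply: (@le_trans _ _ (\sum_(0 <= j < m) `|u j|)); last by rewrite lerDr addr_ge0.
rewrite big_mkord (bigD1 (Ordinal nm))//= lerDl; exact: sumr_ge0.
Qed.

End Pochhammer.
Arguments qprod_cvg {R q0} q01 c.
Arguments qpoch_neq0 {R q0} q01 c.
Arguments q_exp_cvg0 {R q0} q01.
Arguments cvg_bounded {R} u l.

(** * Partial fractions of a finite q-product *)

Section PartialFractions.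
Variable F : fieldType.

(** Cleared of denominators, this is an equality of polynomials in [t] of degree at
most [L]; they agree at the [L] points [u i] and at 0. *)
Lemma partial_fractions (L : nat) (u : 'I_L -> F) (z t : F) :
  injective u -> (forall i, u i != 0) -> (forall i, t != u i) ->
  \prod_i ((t - z * u i) / (t - u i)) = z ^+ L +
    \sum_n (1 - z) * \prod_(i | i != n) ((u n - z * u i) / (u n - u i)) * (t / (t - u n)).
Proof.
move=> uI u0 tu.
pose c n := (1 - z) * \prod_(i | i != n) ((u n - z * u i) / (u n - u i)).
pose W n : {poly F} := \prod_i ('X - (if i == n then 0 else u i)%:P).
pose P : {poly F} := \prod_i ('X - (z * u i)%:P) - z ^+ L *: \prod_i ('X - (u i)%:P)
  - \sum_n c n *: W n.
(* [W n] is 'X times the product over [i != n]; writing it as a full product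
   makes its size the same as that of the other terms. *)
have WE n x : (W n).[x] = x * \prod_(i | i != n) (x - u i).
  rewrite horner_prod (bigD1 n)//= eqxx !hornerE; congr (_ * _); first by rewrite subr0.
  by apply: eq_bigr => i /negPf ->; rewrite !hornerE.
have sz (f : 'I_L -> F) : leq (size (\prod_i ('X - (f i)%:P))) L.+1.
  by rewrite size_prod_XsubC [index_enum _]unlock -enumT size_enum_ord.
have PE x : P.[x] = \prod_i (x - z * u i) - z ^+ L * \prod_i (x - u i) -
    \sum_n c n * (x * \prod_(i | i != n) (x - u i)).
  rewrite /P !hornerE !horner_prod horner_sum; congr (_ - _ * _ - _).
  - by apply: eq_bigr => i _; rewrite !hornerE.
  - by apply: eq_bigr => i _; rewrite !hornerE.
  - by apply: eq_bigr => i _; rewrite hornerE WE.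
have P0 : P = 0.
  apply: contraTeq isT => P0.
  have := @max_poly_roots _ P (0 :: [seq u i | i : 'I_L]) P0.
  rewrite /= size_map size_enum_ord => h.
  suff : (L.+1 < size P)%N.
    rewrite ltnNge => /negP[]; apply: leq_trans (size_polyD _ _) _.
    rewrite geq_max size_polyN; apply/andP; split.
      apply: leq_trans (size_polyD _ _) _; rewrite geq_max size_polyN sz.
      by apply: leq_trans (size_scale_leq _ _) (sz _).
    apply: leq_trans (size_sum _ _ _) _; apply/bigmax_leqP => n _.
    by apply: leq_trans (size_scale_leq _ _) (sz _).
  apply: h.
    rewrite {1}/root PE [X in _ - X]big1 ?subr0 => [|n _]; last by rewrite mul0r mulr0.
    have -> : \prod_i (0 - z * u i) = z ^+ L * \prod_i (0 - u i).
      rewrite -[in z ^+ L](card_ord L) -prodr_const -big_split /=.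
      by apply: eq_bigr => i _; rewrite !sub0r mulrN.
    rewrite subrr eqxx /=; apply/allP => _ /mapP[m _ ->].
    rewrite /root PE [X in _ - _ * X](bigD1 m)//= subrr mul0r mulr0 subr0.
    rewrite [X in X - _](bigD1 m)//= [X in _ - X](bigD1 m)//= [X in _ - (_ + X)]big1 => [|n nm].
      rewrite addr0 /c prodf_div subr_eq0; apply/eqP.
      have : \prod_(i | i != m) (u m - u i) != 0.
        by apply/prodf_neq0 => i im; rewrite subr_eq0 (inj_eq uI) eq_sym.
      move: (\prod_(i | i != m) (u m - u i)) (\prod_(i | i != m) (u m - z * u i)) => A B A0.
      by field.
    by rewrite (bigD1 m) 1?eq_sym//= subrr mul0r !mulr0.
  apply/andP; split; first by apply/mapP => -[i _] /esym/eqP; apply/negP.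
  by rewrite map_inj_uniq// enum_uniq.
have := PE t; rewrite P0 horner0 => /esym/eqP; rewrite subr_eq0 subr_eq => /eqP E.
have T0 : \prod_i (t - u i) != 0 by apply/prodf_neq0 => i _; rewrite subr_eq0.
rewrite prodf_div E mulrDl mulfK// addrC; congr (_ + _).
rewrite mulr_suml; apply: eq_bigr => n _; rewrite -/(c n) -!mulrA; congr (_ * (_ * _)).
rewrite (bigD1 n)//= in T0 *; move: T0; rewrite mulf_eq0 negb_or => /andP[h1 h2].
by field; rewrite h1.
Qed.

End PartialFractions.

Section QPartialFractions.
Context {R : realType}.
Local Notation C := (Cplx R).
Variable q0 : R.
Hypothesis q01 : 0 < q0 < 1.
Let q : C := q0%:C.
Local Notation qp := (qprod q0).

Let qn0 : q != 0. Proof. by rewrite gt_eqF// q_gt0. Qed.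

Lemma q_exp_neq1 n : (0 < n)%N -> 1 - q ^+ n != 0.
Proof.
move=> n0; rewrite subr_eq0 eq_sym lt_eqF// exprn_ilt1 ?q_lt1 -?lt0n//.
by rewrite ltW// q_gt0.
Qed.

Lemma prod_ord_neq (G : nat -> C) L (i : 'I_L) :
  \prod_(j < L | j != i) G j = \prod_(0 <= j < i) G j * \prod_(0 <= k < (L - 1 - i)) G (k + i.+1)%N.
Proof.
have -> : \prod_(j < L | j != i) G j = \prod_(0 <= j < L) if j != i then G j else 1.
  by rewrite big_mkcond big_mkord.
rewrite (@big_cat_nat _ _ _ i)//= ?(ltnW (ltn_ord i))//.
rewrite [in X in _ * X]big_ltn// eqxx mul1r; congr (_ * _).
  by apply: eq_big_nat => j /andP[_ ji]; rewrite ltn_eqF.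
rewrite -{1}[i.+1]add0n big_addn.
have -> : (L - i.+1 = L - 1 - i)%N by lia.
by apply: eq_big_nat => j _; rewrite gtn_eqF// addnS ltnS leq_addl.
Qed.

(** The case [u i = q^i] and [t = 1/b] of [partial_fractions].  In the residue at
[1/b = q^i], the factors with [j > i] give a product in base [q], and those with
[j < i] give one in [q/z] after extracting [z^i]. *)
Lemma q_partial_fractions L (b z : C) : z != 0 -> b != 0 ->
  (forall j : nat, b * q ^+ j != 1) ->
  qp (b * z) L / qp b L = z ^+ L +
   \sum_(i < L) z ^+ i * (qp z (L - 1 - i).+1 / qp q (L - 1 - i)) *
      (qp (q / z) i / qp q i) / (1 - b * q ^+ i).
Proof.
move=> z0 b0 b1.
have inj : injective (fun i : 'I_L => q ^+ i).
  by move=> i j /(ieexprIn (q_gt0 q01) (negbT (lt_eqF (q_lt1 q01))))/val_inj.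
have tu (i : 'I_L) : b^-1 != q ^+ i.
  apply: contra_neq (b1 i) => <-; by rewrite divff.
have := partial_fractions z inj (fun i => expf_neq0 i qn0) tu.
have -> : \prod_(i < L) ((b^-1 - z * q ^+ i) / (b^-1 - q ^+ i)) = qp (b * z) L / qp b L.
  rewrite /qprod !big_mkord -prodf_div; apply: eq_bigr => i _.
  have h : 1 - b * q ^+ i != 0 by rewrite subr_eq0 eq_sym.
  have h' : b^-1 - q ^+ i != 0 by rewrite subr_eq0.
  have -> : b^-1 - q ^+ i = (1 - b * q ^+ i) / b by field.
  by rewrite -/q; field; rewrite h.
move=> ->; congr (_ + _); apply: eq_bigr => i _.
have -> : b^-1 / (b^-1 - q ^+ i) = (1 - b * q ^+ i)^-1.
  have h : 1 - b * q ^+ i != 0 by rewrite subr_eq0 eq_sym.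
  have -> : b^-1 - q ^+ i = (1 - b * q ^+ i) / b by field.
  by field; rewrite h.
congr (_ / _).
rewrite (prod_ord_neq (fun j => (q ^+ i - z * q ^+ j) / (q ^+ i - q ^+ j))).
have -> : \prod_(0 <= j < i) ((q ^+ i - z * q ^+ j) / (q ^+ i - q ^+ j)) =
    z ^+ i * (qp (q / z) i / qp q i).
  rewrite big_nat_rev /= add0n /qprod -prodf_div.
  rewrite -[in z ^+ i](subn0 i) -prodr_const_nat -big_split /=.
  apply: eq_big_nat => j /andP[_ ji].
  have e : q ^+ i = q ^+ (i - j.+1) * (q * q ^+ j) by rewrite -exprS -exprD subnK.
  have := q_exp_neq1 (ltn0Sn j); rewrite exprS e -/q => h.
  have h1 : q ^+ (i - j.+1) != 0 by rewrite expf_neq0.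
  have -> : q ^+ (i - j.+1) * (q * q ^+ j) - q ^+ (i - j.+1) =
    - q ^+ (i - j.+1) * (1 - q * q ^+ j) by ring.
  by move: (q) h h1 => Q h h1; field; rewrite h h1 ?z0.
have -> : \prod_(0 <= k < (L - 1 - i)) ((q ^+ i - z * q ^+ (k + i.+1)) / (q ^+ i - q ^+ (k + i.+1)))
   = qp (z * q) (L - 1 - i) / qp q (L - 1 - i).
  rewrite /qprod -prodf_div; apply: eq_big_nat => j _.
  have e : q ^+ (j + i.+1) = q ^+ i * (q * q ^+ j) by rewrite -exprS -exprD addnC addSnnS.
  have := q_exp_neq1 (ltn0Sn j); rewrite exprS e -/q => h.
  have h1 : q ^+ i != 0 by rewrite expf_neq0.
  have -> : q ^+ i - q ^+ i * (q * q ^+ j) = q ^+ i * (1 - q * q ^+ j) by ring.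
  by move: (q) h h1 => Q h h1; field; rewrite h h1 ?z0.
rewrite -[(L - 1 - i).+1]add1n qprodD expr1 -/q.
have -> : qp z 1 = 1 - z by rewrite /qprod big_nat1 expr0 mulr1.
have regroup : forall (s u v w x : C), s * (u * v * (w / x)) = u * (s * w / x) * v
  by move=> *; ring.
exact: regroup.
Qed.

End QPartialFractions.

(** * Kronecker's bilateral series *)

Section Kronecker.
Context {R : realType}.
Local Notation C := (Cplx R).
Variable q0 : R.
Hypothesis q01 : 0 < q0 < 1.
Let q : C := q0%:C.
Local Notation qp := (qprod q0).

Let qn0 : q != 0. Proof. by rewrite gt_eqF// q_gt0. Qed.

(** Reversing the factors, [(d q^(-M); q)_M] equals [d^M (q/d; q)_M] up to a factor
that does not depend on [d]; compare [d = c] and [d = c z]. *)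
Lemma qprod_negative_shift (c z : C) M : c != 0 -> z != 0 ->
  qp (c * z * q ^- M) M * qp (q / c) M = z ^+ M * qp (q / (c * z)) M * qp (c * q ^- M) M.
Proof.
move=> c0 z0.
have E d : d != 0 -> qp (d * q ^- M) M =
    (\prod_(0 <= k < M) (- q ^- k.+1)) * d ^+ M * qp (q / d) M.
  move=> d0; rewrite {1}/qprod big_nat_rev /= add0n -[in d ^+ M](subn0 M).
  rewrite -prodr_const_nat -!big_split /=; apply: eq_big_nat => k /andP[_ kM].
  have e : q ^- M * q ^+ (M - k.+1) = q ^- k.+1.
    by rewrite -{1}(subnK kM) exprD invfM mulrAC mulVf ?mul1r// expf_neq0.
  rewrite -/q -[d * _ * _]mulrA e exprS; have := expf_neq0 k qn0.
  by move: (q) qn0 => Q Q0 Qk; field; rewrite Q0 Qk d0.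
rewrite !E ?mulf_neq0// exprMn; ring.
Qed.

Let v z k : C := qp z k.+1 / qp q k.
Let w z k : C := qp (q / z) k / qp q k.

(** [q_partial_fractions] with [2M+1] points, recentred by [b = a q^(-M)] and divided
by [z^M]. *)
Lemma finite_kronecker M (a z : C) : a != 0 -> z != 0 -> (forall n : int, a * q ^ n != 1) ->
  qp (a * z) M.+1 * qp (q / (a * z)) M / (qp a M.+1 * qp (q / a) M) =
  z ^+ M.+1 + \sum_(i < M + M.+1)
     z ^ (i%:Z - M%:Z) / (1 - a * q ^ (i%:Z - M%:Z)) * (v z (M + M - i) * w z i).
Proof.
move=> a0 z0 a1.
have b0 : a * q ^- M != 0 by rewrite mulf_neq0// invr_neq0// expf_neq0.
have bq (i : nat) : a * q ^- M * q ^+ i = a * q ^ (i%:Z - M%:Z).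
  by rewrite expfzDr// -exprnN -!exprnP; ring.
have b1 (j : nat) : a * q ^- M * q ^+ j != 1 by rewrite bq.
have := q_partial_fractions q01 (M + M.+1) z0 b0 b1.
have qM : q ^- M * q ^+ M = 1 by rewrite mulVf// expf_neq0.
rewrite !qprodD (mulrAC a) -!(mulrA _ (q ^- M) (q ^+ M)) qM !mulr1 => E.
have zM0 := expf_neq0 M z0.
have qa0 : qp (q / a) M != 0.
  apply: qprod_neq0 => j; apply: contraNneq (a1 (- j.+1%:Z)) => h.
  have /(canRL (mulfK _)) : q ^+ j.+1 / a = 1 by rewrite -h exprS mulrAC.
  rewrite invr_eq0 => /(_ a0) e; rewrite -exprnN e mul1r invrK mulfV//.
have qa'0 : qp (a * q ^- M) M != 0 by apply: qprod_neq0.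
have qa1 : qp a M.+1 != 0.
  by apply: qprod_neq0 => j; rewrite exprnP.
have S := qprod_negative_shift M a0 z0.
apply: (mulfI zM0); rewrite mulrDr -exprD -[(M + _)%N in RHS]/(M + M.+1)%N.
transitivity (qp (a * z * q ^- M) M * qp (a * z) M.+1 / (qp (a * q ^- M) M * qp a M.+1)).
  apply/eqP; rewrite -subr_eq0; apply/eqP.
  move: S qa0 qa'0 qa1.
  move: (qp (a * z * q ^- M) M) (qp (q / a) M) (z ^+ M) (qp (q / (a * z)) M)
    (qp (a * q ^- M) M) (qp (a * z) M.+1) (qp a M.+1) => s1 s2 s3 s4 s5 s6 s7 S h2 h5 h7.
  have -> : s1 = s3 * s4 * s5 / s2 by rewrite -S mulfK.
  by field; rewrite h2 h5 h7.
rewrite E mulr_sumr; congr (_ + _); apply: eq_bigr => i _.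
rewrite bq /v /w; have -> : (M + M.+1 - 1 - i = M + M - i)%N by clear; lia.
rewrite (expfzDr _ _ z0) -!exprnN -!exprnP; move: (_ / qp q _) (_ / qp q i) => A B.
by move: (1 - _)^-1 => D; field.
Qed.

(** For [n = k] the kernel [1/(1-aq^n)] tends to 1, and for [n = -k] it equals
[q^k/(q^k-a)]; so it is bounded, with a gain of [q^k] at negative indices. *)
Lemma kernel_bound (a : C) : a != 0 -> (forall n : int, a * q ^ n != 1) ->
  exists A : C, forall k : nat,
    `|(1 - a * q ^ k%:Z)^-1| <= A /\ `|(1 - a * q ^ (- k%:Z))^-1| <= A * q ^+ k.
Proof.
move=> a0 a1; have q0c := q_exp_cvg0 q01.
have c1 : (1 - a * q ^+ k)^-1 @[k --> \oo] --> (1 - a * 0)^-1.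
  apply: cvgV; first by rewrite mulr0 subr0 oner_eq0.
  by apply: cvgB; [exact: cvg_cst|apply: cvgM; [exact: cvg_cst|exact: q0c]].
have c2 : (q ^+ k - a)^-1 @[k --> \oo] --> (0 - a)^-1.
  apply: cvgV; first by rewrite sub0r oppr_eq0.
  by apply: cvgB; [exact: q0c|exact: cvg_cst].
have [A1 hA1] := cvg_bounded _ _ c1; have [A2 hA2] := cvg_bounded _ _ c2.
have A10 : 0 <= A1 by exact: le_trans (hA1 0%N).
have A20 : 0 <= A2 by exact: le_trans (hA2 0%N).
exists (A1 + A2) => k; split.
  by apply: le_trans (hA1 k) _; rewrite lerDl.
have qk : q ^+ k != 0 by rewrite expf_neq0.
have h : q ^+ k - a != 0.
  by rewrite subr_eq0; apply: contra_neq (a1 (- k%:Z)) => <-; rewrite -exprnN divff.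
have -> : (1 - a * q ^ (- k%:Z))^-1 = (q ^+ k - a)^-1 * q ^+ k.
  have -> : 1 - a * q ^ (- k%:Z) = (q ^+ k - a) / q ^+ k.
    by rewrite -exprnN mulrBl divff.
  by rewrite invfM invrK.
have q_ge0 : 0 <= q ^+ k by rewrite exprn_ge0// ltW// q_gt0.
rewrite normrM (ger0_norm q_ge0) ler_wpM2r//.
by apply: le_trans (hA2 k) _; rewrite lerDr.
Qed.

Variable r0 : R.
Hypothesis r01 : 0 < r0 < 1.
Let r : C := r0%:C.
Hypothesis rq : q = r ^+ 2.

(** On the circle [|z| = r] with [r^2 = q], the terms are [O(r^|n|)] at both ends. *)
Lemma kernel_summable (a z : C) : a != 0 -> (forall n : int, a * q ^ n != 1) ->
  `|z| = r -> abs_summable (fun n : int => z ^ n / (1 - a * q ^ n)).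
Proof.
move=> a0 a1 zr; have [A hA] := kernel_bound a0 a1.
have r_gt0 : 0 < r by exact: q_gt0.
have rn0 : r != 0 by rewrite gt_eqF.
have r_ge0 n : 0 <= r ^+ n by rewrite exprn_ge0// ltW.
have A0 : 0 <= A by apply: le_trans (proj1 (hA 0%N)).
apply: (abs_summable_le (g := fun n : int => A * r ^+ `|n|)).
  2: exact: abs_summableZ (abs_summable_geom_int (q_ge0lt1 r01)).
move=> n; rewrite !normrM (ger0_norm A0) (ger0_norm (r_ge0 _)) mulrC.
case: n => k; rewrite ?NegzE.
  rewrite -exprnP normrX zr; apply: ler_pM => //; exact: (proj1 (hA k)).
rewrite abszN absz_nat -(exprnN z) [X in _ * X <= _]normfV normrX zr; have /proj2 h := hA k.+1.
apply: le_trans (ler_wpM2r _ h) _; first by rewrite invr_ge0 r_ge0.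
have -> : q ^+ k.+1 = r ^+ k.+1 * r ^+ k.+1 by rewrite rq -exprM mul2n -addnn exprD.
rewrite mulrA (mulfK (expf_neq0 k.+1 rn0)); exact: lexx.
Qed.

(** The modified Jacobi theta function [(c, p/c; p)_oo]. *)
Definition theta (p c : C) : C := qpochs [:: c; p / c] p.

Lemma thetaE p c : theta p c = qpoch c p * qpoch (p / c) p.
Proof. by rewrite /theta /qpochs !big_cons big_nil mulr1. Qed.

Lemma theta_neq0 (a : C) : a != 0 -> (forall n : int, a * q ^ n != 1) -> theta q a != 0.
Proof.
move=> a0 a1; rewrite thetaE mulf_neq0//; apply: (qpoch_neq0 q01) => j.
  by rewrite exprnP.
apply: contraNneq (a1 (- j.+1%:Z)) => h.
have e : q ^+ j.+1 = a by rewrite exprS -[RHS]mul1r -h mulrAC mulfVK.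
by rewrite -exprnN e mulfV.
Qed.

Lemma circle_neq1 (z : C) : `|z| = r -> forall n : int, z * q ^ n != 1.
Proof.
move=> zr n; apply/eqP => /(congr1 Num.norm); rewrite normr1 normrM zr.
have r_gt0 : 0 < r by exact: q_gt0.
have r_lt1 : r < 1 by exact: q_lt1.
have rn k : r ^+ k.+1 != 1 by rewrite lt_eqF// exprn_ilt1// ltW.
have nq k : `|q ^+ k| = r ^+ (2 * k).
  by rewrite rq -exprM ger0_norm// exprn_ge0// ltW.
case: n => k; rewrite ?NegzE.
  by rewrite -exprnP nq -exprS; apply/eqP.
have e : r ^+ (2 * k.+1) = r * r ^+ (2 * k).+1 by rewrite -exprS; congr (_ ^+ _); lia.
rewrite -exprnN normfV nq e invfM mulrA mulfV ?gt_eqF// mul1r => /eqP.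
by rewrite invr_eq1; apply/negP; exact: rn.
Qed.

Lemma cvg_quotient (s t : nat -> C) (l m : C) :
  s @ \oo --> l -> t @ \oo --> m -> m != 0 -> s k / t k @[k --> \oo] --> l / m.
Proof. by move=> sl tm m0; apply: cvgM; [exact: sl|exact: (cvgV m0 tm)]. Qed.

Lemma qprod_cvgS c : qp c k.+1 @[k --> \oo] --> qpoch c q.
Proof.
have := qprod_cvg q01 c; rewrite -(cvg_shiftn 1); apply: cvg_trans.
by apply: near_eq_cvg; near=> n; rewrite /= addn1.
Unshelve. all: by end_near.
Qed.

(** Let [M] tend to infinity in [finite_kronecker].  Each term tends to
[z^n/(1-aq^n)] times a constant, and the coefficients are bounded uniformly
in [M] and [n], so Tannery's theorem applies. *)
Theorem kronecker (a z : C) : a != 0 -> (forall n : int, a * q ^ n != 1) -> `|z| = r ->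
  sum (fun n : int => z ^ n / (1 - a * q ^ n)) =
    qpoch q q ^+ 2 * theta q (a * z) / (theta q a * theta q z).
Proof.
move=> a0 a1 zr.
have r_gt0 : 0 < r by exact: q_gt0.
have z0 : z != 0 by rewrite -normr_eq0 zr gt_eqF.
have z1 := circle_neq1 zr.
have fs := kernel_summable a0 a1 zr.
pose f (n : int) := z ^ n / (1 - a * q ^ n); rewrite -/f.
have qq0 : qpoch q q != 0.
  by apply: (qpoch_neq0 q01) => j; rewrite -exprS eq_sym -subr_eq0 q_exp_neq1.
have vl : v z k @[k --> \oo] --> qpoch z q / qpoch q q.
  exact: (@cvg_quotient (fun k => qp z k.+1) _ _ _ (@qprod_cvgS z) (qprod_cvg q01 q) qq0).
have wl : w z k @[k --> \oo] --> qpoch (q / z) q / qpoch q q.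
  exact: cvg_quotient (qprod_cvg q01 (q / z)) (qprod_cvg q01 q) qq0.
have [Bv hBv] := cvg_bounded _ _ vl; have [Bw hBw] := cvg_bounded _ _ wl.
(* The finite identity as a family on all integers, supported on [-M, M]. *)
pose F M (n : int) := if (`|n| <= M)%N then
  f n * (v z (absz (M%:Z - n)%R) * w z (absz (M%:Z + n)%R)) else 0.
pose c := qpoch z q / qpoch q q * (qpoch (q / z) q / qpoch q q).
have lim1 : sum (F M) @[M --> \oo] --> sum (fun n => c * f n).
  have Bv0 : 0 <= Bv by exact: le_trans (hBv 0%N).
  have Bw0 : 0 <= Bw by exact: le_trans (hBw 0%N).
  have D0 : `|Bv * Bw + `|c| | = Bv * Bw + `|c| by rewrite ger0_norm// addr_ge0// mulr_ge0.
  apply: (tannery (g := fun n => (Bv * Bw + `|c|) * f n)).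
  - move=> M n; rewrite /F; case: ifP => _; last by rewrite normr0.
    rewrite mulrC normrM [leRHS]normrM; apply: ler_wpM2r => //; rewrite D0.
    by apply: (@le_trans _ _ (Bv * Bw)); [rewrite normrM ler_pM|rewrite lerDl].
  - by move=> n; rewrite normrM [leRHS]normrM; apply: ler_wpM2r => //; rewrite D0 lerDr mulr_ge0.
  - exact: abs_summableZ.
  - move=> n; rewrite [X in _ --> X]mulrC.
    have h : f n * (v z (absz (M%:Z - n)%R) * w z (absz (M%:Z + n)%R)) @[M --> \oo] --> f n * c.
      apply: cvgM; first exact: cvg_cst.
      apply: cvgM.
        apply: cvg_comp vl => A [N _ NA]; exists (N + `|n|)%N => // M /= MN; apply: NA => /=; clear -MN; lia.
      apply: cvg_comp wl => A [N _ NA]; exists (N + `|n|)%N => // M /= MN; apply: NA => /=; clear -MN; lia.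
    apply: cvg_trans h; apply: near_eq_cvg; exists `|n|%N => // M /= Mn.
    by rewrite /F Mn.
have sumF M : sum (F M) = qp (a * z) M.+1 * qp (q / (a * z)) M / (qp a M.+1 * qp (q / a) M)
    - z ^+ M.+1.
  rewrite finite_kronecker// addrC addKr.
  pose s := [seq i%:Z - M%:Z | i <- index_iota 0 (M + M.+1)].
  rewrite (@sum_finite_support _ _ _ [fset n in s]%fset); last first.
    move=> n; rewrite inE /F; case: ifP => // nM /negP[]; apply/mapP.
    exists (absz (n + M%:Z)%R); rewrite ?mem_index_iota; clear -nM; lia.
  have -> : \sum_(n <- [fset n in s]%fset) F M n = \sum_(n <- s) F M n.
    apply/perm_big/uniq_perm; rewrite ?fset_uniq//.
      by rewrite map_inj_uniq ?iota_uniq// => i j; clear; lia.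
    by move=> n; rewrite inE.
  rewrite big_map big_mkord; apply: eq_bigr => i _.
  have iM := ltn_ord i; rewrite /F /f ifT; last by clear -iM; lia.
  have -> : absz (M%:Z - (i%:Z - M%:Z))%R = (M + M - i)%N by clear -iM; lia.
  by have -> : absz (M%:Z + (i%:Z - M%:Z))%R = i by clear; lia.
have lim2 : sum (F M) @[M --> \oo] --> theta q (a * z) / theta q a - 0.
  have -> : (fun M => sum (F M)) = (fun M => qp (a * z) M.+1 * qp (q / (a * z)) M /
      (qp a M.+1 * qp (q / a) M) - z ^+ M.+1) by apply/funext.
  apply: cvgB.
    have P c' : qp c' M.+1 * qp (q / c') M @[M --> \oo] --> theta q c'.
      rewrite thetaE; apply: cvgM; [exact: qprod_cvgS|exact: (qprod_cvg q01 (q / c'))].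
    exact: (@cvg_quotient (fun M => _ * _) (fun M => _ * _) _ _ (P (a * z)) (P a)
      (theta_neq0 a0 a1)).
  apply/cvgrPdist_lt => e e0; have /cvgrPdist_lt/(_ e e0)[N _ NP] := q_exp_cvg0 r01.
  exists N => // M /= NM; have := NP M.+1 (leq_trans NM (leqnSn M)).
  by rewrite /= !sub0r !normrN !normrX zr -/r ger0_norm// ltW.
have tz0 : theta q z != 0 := theta_neq0 z0 z1.
have ta0 : theta q a != 0 := theta_neq0 a0 a1.
have : sum (fun n => c * f n) = theta q (a * z) / theta q a - 0.
  exact: (cvg_unique (@norm_hausdorff C C) lim1 lim2).
rewrite (sumZ c fs) subr0 /c; move: ta0 tz0; rewrite [theta q z]thetaE => ta0.
rewrite mulf_eq0 negb_or => /andP[z10 z20] h.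
have -> : sum f = theta q (a * z) / theta q a *
   ((qpoch q q ^+ 2) / (qpoch z q * qpoch (q / z) q)).
  by rewrite -h; field; rewrite qq0 z10 z20.
by rewrite mulf_div [qpoch q q ^+ 2 * _]mulrC.
Unshelve. all: by end_near.
Qed.

End Kronecker.
Arguments kernel_summable {R q0} q01 {r0} r01 rq a z.
Arguments circle_neq1 {R q0} q01 {r0} r01 rq z.
Arguments theta_neq0 {R q0} q01 a.
Arguments kronecker {R q0} q01 {r0} r01 rq a z.

(** * Cube roots of unity *)

Section CubeRoot.
Context {R : realType}.
Local Notation C := (Cplx R).

Lemma rhoE : rho = (cos (2 * pi / 3) +i* sin (2 * pi / 3) : C).
Proof.
have e : 2 * pi%:C * 'i%C / 3 = (0 +i* (2 * pi / 3) : C).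
  rewrite mulrAC; have -> : 2 * pi%:C / 3 = ((2 * pi / 3)%:C : C).
    by rewrite !rmorphM /= fmorphV !rmorph_nat.
  by apply/eqP; rewrite eq_complex /=; apply/andP; split; apply/eqP; ring.
by rewrite /rho e /cexp /= expR0 mul1r.
Qed.

Lemma rho_cubed : rho ^+ 3 = 1 :> C.
Proof.
have polarM (s t : R) : (cos s +i* sin s) * (cos t +i* sin t) =
    cos (s + t) +i* sin (s + t) :> C.
  by apply/eqP; rewrite eq_complex /= cosD sinD; apply/andP; split; apply/eqP; ring.
rewrite rhoE !exprS expr0 mulr1 !polarM.
have -> : 2 * pi / 3 + (2 * pi / 3 + 2 * pi / 3) = pi *+ 2 :> R by field.
by rewrite cos2pi sin2pi.
Qed.

Lemma rho_neq1 : rho != 1 :> C.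
Proof.
rewrite rhoE; apply/eqP => /(congr1 (@complex.Im R)) /= s0.
have : 0 < sin (2 * pi / 3) :> R by apply: sin_gt0_pi; have := pi_gt0 R; lra.
by rewrite s0 ltxx.
Qed.

Lemma rho_sum : 1 + rho + rho ^+ 2 = 0 :> C.
Proof.
apply: (mulfI (_ : rho - 1 != 0)); first by rewrite subr_eq0 rho_neq1.
rewrite mulr0; transitivity (rho ^+ 3 - 1 : C); first by ring.
by rewrite rho_cubed subrr.
Qed.

Lemma rho_neq0 : rho != 0 :> C.
Proof. by apply/eqP => r0; have /eqP := rho_cubed; rewrite r0 expr0n eq_sym oner_eq0. Qed.

Lemma norm_rho : `|rho : C| = 1.
Proof. by apply/eqP; rewrite -(@pexpr_eq1 _ _ 3)// -normrX rho_cubed normr1. Qed.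

Lemma cube_factor (y : C) : (1 - y) * (1 - rho * y) * (1 - rho ^+ 2 * y) = 1 - y ^+ 3.
Proof.
transitivity (1 - y * (1 + rho + rho ^+ 2) + y ^+ 2 * rho * (1 + rho + rho ^+ 2) - rho ^+ 3 * y ^+ 3 : C).
  by ring.
by rewrite rho_sum rho_cubed; ring.
Qed.

Section Cube.
Variable q0 : R.
Hypothesis q01 : 0 < q0 < 1.
Let q : C := q0%:C.

Lemma cube_lt1 : 0 < q0 ^+ 3 < 1.
Proof. by case/andP: q01 => h1 h2; rewrite exprn_gt0//= exprn_ilt1// ltW. Qed.

Lemma qpoch_cube c :
  qpoch c q * qpoch (rho * c) q * qpoch (rho ^+ 2 * c) q = qpoch (c ^+ 3) (q ^+ 3).
Proof.
have e : q ^+ 3 = (q0 ^+ 3)%:C by rewrite rmorphXn.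
have l1 : qprod q0 c n * qprod q0 (rho * c) n * qprod q0 (rho ^+ 2 * c) n @[n --> \oo] -->
    qpoch c q * qpoch (rho * c) q * qpoch (rho ^+ 2 * c) q.
  apply: cvgM; last exact: (qprod_cvg q01).
  by apply: cvgM; exact: (qprod_cvg q01).
have := qprod_cvg cube_lt1 (c ^+ 3); rewrite -e => l2.
apply: (cvg_unique (@norm_hausdorff C C) l1); apply: cvg_trans l2.
apply: near_eq_cvg; near=> n; rewrite /qprod -!big_split /=; apply: eq_bigr => j _.
rewrite -/q -e -(mulrA rho c) -(mulrA (rho ^+ 2) c) cube_factor [(c * _) ^+ 3]exprMn [(q ^+ 3) ^+ _]exprAC.
Unshelve. all: by end_near.
Qed.

(** [qpoch_cube] at [c] and at [q/c]: the map [c |-> q/c] exchanges the factors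
[rho] and [rho^2]. *)
Lemma theta_cube c : c != 0 ->
  theta q c * theta q (rho * c) * theta q (rho ^+ 2 * c) = theta (q ^+ 3) (c ^+ 3).
Proof.
move=> c0; rewrite !thetaE.
have -> : q ^+ 3 / c ^+ 3 = (q / c) ^+ 3 by rewrite expr_div_n.
have r30 := rho_cubed.
have r0 := rho_neq0.
have w1 (Q w : C) : w != 0 -> w ^+ 3 = 1 -> Q / (w * c) = w ^+ 2 * (Q / c).
  by move=> w0 w3; rewrite -[LHS]mul1r -w3; field; rewrite w0 c0.
have w2 (Q w : C) : w != 0 -> w ^+ 3 = 1 -> Q / (w ^+ 2 * c) = w * (Q / c).
  by move=> w0 w3; rewrite -[LHS]mul1r -w3; field; rewrite w0 c0.
rewrite w1// w2//; have := @qpoch_cube c; have := @qpoch_cube (q / c).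
move: (rho) => w <- <-; ring.
Qed.
End Cube.
End CubeRoot.

(** * Comparing Laurent coefficients on a circle *)

Section Transfer.
Context {R : realType}.
Local Notation C := (Cplx R).

Lemma norm_exprz (z : C) (n : int) : `|z ^ n| = `|z| ^ n.
Proof. by case: n => k; rewrite ?NegzE -?exprnN -?exprnP ?normfV normrX. Qed.

(** ['X^L - 1] splits and is separable. *)
Lemma prim_root_exists (L : nat) : (0 < L)%N -> exists w : C, L.-primitive_root w.
Proof.
move=> L0; have [rs E] := closed_field_poly_normal ('X^L - 1 : {poly C}).
have L0' : L%:R != 0 :> C by rewrite pnatr_eq0 -lt0n.
have lc : lead_coef ('X^L - 1 : {poly C}) = 1 by rewrite lead_coefXnsubC.
rewrite lc scale1r in E.
have /hasP[w _ wL] : has L.-primitive_root rs; last by exists w.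
apply: cyclic.has_prim_root => //.
- by apply/allP => w wr; rewrite /root_of_unity E root_prod_XsubC.
- by rewrite -separable.separable_prod_XsubC -E cyclotomic.separable_Xn_sub_1.
- by have := congr1 (fun p : {poly C} => size p) E; rewrite size_prod_XsubC size_XnsubC// => -[->].
Qed.

(** Fourier inversion on the cyclic group of order [L], for functions of an integer
argument that depend only on its residue. *)
Lemma finite_fourier (L : nat) (w : C) (p : nat -> C) : (0 < L)%N -> L.-primitive_root w ->
  exists c : 'I_L -> C, forall n : int,
    \sum_k c k * (w ^+ k) ^ n = p (absz (n %% L%:Z)%Z).
Proof.
move=> L0 wL; have w0 : w != 0 by rewrite (prim_root_eq0 wL) -lt0n.
have L0' : L%:R != 0 :> C by rewrite pnatr_eq0 -lt0n.
(* The inverse discrete Fourier transform of [p]. *)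
exists (fun k => L%:R^-1 * \sum_(s < L) p s * (w ^+ k) ^ (- s%:Z)) => n.
pose t := absz (n %% L%:Z)%Z.
have tE : (n %% L%:Z)%Z = t%:Z by rewrite /t gez0_abs// modz_ge0// lt0r_neq0.
have tL : (t < L)%N by rewrite -ltz_nat -tE ltz_pmod.
have wn : w ^ n = w ^+ t.
  have -> : w ^ n = (w ^ L%:Z) ^ (n %/ L%:Z)%Z * w ^ t%:Z.
    by rewrite exprz_exp -expfzDr// mulrC -tE -divz_eq.
  by rewrite -!exprnP (prim_expr_order wL) exp1rz mul1r.
have wk (k : nat) (m : int) : (w ^+ k) ^ m = (w ^ m) ^+ k.
  by rewrite !exprnP !exprz_exp mulrC.
rewrite -/t; under eq_bigr => k _.
  rewrite -mulrA mulr_suml mulr_sumr.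
  under eq_bigr => s _ do rewrite -mulrA !wk wn -exprMn -exprnN.
  over.
rewrite exchange_big (bigD1 (Ordinal tL))//= [X in _ + X]big1 => [|s st].
  rewrite addr0; under eq_bigr do rewrite mulVf ?expf_neq0// expr1n mulr1.
  by rewrite sumr_const card_ord -mulrnAl -[_ *+ L]mulr_natr mulVf// mul1r.
under eq_bigr do rewrite mulrA; rewrite -mulr_sumr.
have y1 : w ^- s * w ^+ t != 1.
  rewrite mulrC; apply: contraNneq st => /(canRL (mulfK _)).
  rewrite mul1r invr_eq0 expf_neq0// invrK => /(_ isT) e; rewrite -val_eqE /=.
  have := eq_prim_root_expr wL t s; rewrite e eqxx !modn_small//.
  by rewrite eq_sym => <-.
have := subrX1 (w ^- s * w ^+ t) L.
have -> : (w ^- s * w ^+ t) ^+ L = 1.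
  by rewrite exprMn exprVn -!exprM ![(_ * L)%N]mulnC !exprM (prim_expr_order wL) !expr1n invr1 mulr1.
by rewrite subrr => /esym/eqP; rewrite mulf_eq0 subr_eq0 (negPf y1) /= => /eqP ->; rewrite mulr0.
Qed.

(** The finite linear combinations of the characters [n |-> z^n] with [|z| = r]. *)
Definition circle_combination (r : C) (psi : int -> C) :=
  exists (L : nat) (c z : 'I_L -> C),
    (forall k, `|z k| = r) /\ forall n, psi n = \sum_k c k * z k ^ n.

(** [psi m] is the function that agrees with [phi] on [-m, m] and for which
[psi m n / r^n] is periodic of period [2m+1]; the bound on [phi n / r^n] is
inherited. *)
Lemma circle_approximation (r B : C) (phi : int -> C) : 0 < r ->
  (forall n, `|phi n| <= B * r ^ n) ->
  exists psi : nat -> int -> C, forall m,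
    [/\ circle_combination r (psi m), forall n, `|psi m n| <= B * r ^ n &
        forall n, (`|n| <= m)%N -> psi m n = phi n].
Proof.
move=> r0 phiB; have rn0 : r != 0 by rewrite gt_eqF.
(* [p m s] for [0 <= s <= 2m] lists the values of [phi n / r^n] at [n = s - m]. *)
pose p (m s : nat) := phi (s%:Z - m%:Z) * r ^ (- (s%:Z - m%:Z)).
pose L m := (m + m).+1.
exists (fun m n => p m (absz ((n + m%:Z) %% (L m)%:Z)%Z) * r ^ n) => m; split.
- have [w wL] := prim_root_exists (ltn0Sn (m + m)).
  have w0 : w != 0 by rewrite (prim_root_eq0 wL).
  have [c cP] := finite_fourier (p m) (ltn0Sn (m + m)) wL.
  exists (L m), (fun k => c k * (w ^+ k) ^ m%:Z), (fun k => r * w ^+ k); split.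
    have w1 : `|w| = 1.
      apply/eqP; rewrite -(@pexpr_eq1 _ _ (L m))//.
      by rewrite -normrX (prim_expr_order wL) normr1.
    by move=> k; rewrite normrM normrX w1 expr1n mulr1 gtr0_norm.
  move=> n; rewrite -cP mulr_suml; apply: eq_bigr => k _.
  rewrite expfzMl expfzDr ?expf_neq0//; ring.
- move=> n; rewrite normrM (ger0_norm (exprz_ge0 n (ltW r0))).
  apply: ler_wpM2r; first exact: exprz_ge0 (ltW r0).
  rewrite /p normrM.
  set s := _ - _; apply: le_trans (ler_wpM2r _ (phiB s)) _ => //.
  by rewrite (ger0_norm (exprz_ge0 _ (ltW r0))) -mulrA -expfzDr// subrr expr0z mulr1.
- move=> n nm; rewrite /L modz_small; last by clear -nm; lia.
  rewrite /p gez0_abs; last by clear -nm; lia.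
  by rewrite addrK -mulrA -expfzDr// addNr expr0z mulr1.
Qed.

(** If two families have the same Laurent series on the circle [|z| = r], then [z^n]
may be replaced by any weight [phi n] that is [O(r^n)]: the equality extends by
linearity to [circle_combination]s, then to [phi] by Tannery's theorem. *)
Lemma weighted_sum_transfer (I J : choiceType) (f : I -> C) (N : I -> int)
    (g : J -> C) (P : J -> int) (r B K : C) (phi : int -> C) : 0 < r ->
  abs_summable (fun i => f i * r ^ N i) -> abs_summable (fun j => g j * r ^ P j) ->
  (forall z, `|z| = r ->
     sum (fun j => g j * z ^ P j) = K * sum (fun i => f i * z ^ N i)) ->
  (forall n, `|phi n| <= B * r ^ n) ->
  [/\ abs_summable (fun i => f i * phi (N i)), abs_summable (fun j => g j * phi (P j)) &
      sum (fun j => g j * phi (P j)) = K * sum (fun i => f i * phi (N i))].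
Proof.
move=> r0 fs gs H phiB.
have B0 : 0 <= B by have := le_trans (normr_ge0 _) (phiB 0); rewrite expr0z mulr1.
have [psi psiP] := circle_approximation r0 phiB.
have dom (I' : choiceType) (f' : I' -> C) (N' : I' -> int) (ph : int -> C) :
    (forall n, `|ph n| <= B * r ^ n) ->
    forall i, `|f' i * ph (N' i)| <= `|B * (f' i * r ^ N' i)|.
  move=> phB i; rewrite mulrCA !normrM ler_wpM2l// (ger0_norm B0).
  by rewrite (ger0_norm (exprz_ge0 _ (ltW r0))) phB.
have summ (I' : choiceType) (f' : I' -> C) (N' : I' -> int) (ph : int -> C) :
    abs_summable (fun i => f' i * r ^ N' i) -> (forall n, `|ph n| <= B * r ^ n) ->
    abs_summable (fun i => f' i * ph (N' i)).
  move=> fs' phB; apply: abs_summable_le (abs_summableZ B fs'); exact: dom.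
have lim (I' : choiceType) (f' : I' -> C) (N' : I' -> int) :
    abs_summable (fun i => f' i * r ^ N' i) ->
    sum (fun i => f' i * psi m (N' i)) @[m --> \oo] --> sum (fun i => f' i * phi (N' i)).
  move=> fs'; apply: (tannery (g := fun i => B * (f' i * r ^ N' i))).
  - by move=> m; apply: dom => n; have [_ + _] := psiP m; apply.
  - exact: dom.
  - exact: abs_summableZ.
  - move=> i; apply: cvgM; first exact: cvg_cst.
    apply: cvg_near_cst; exists `|N' i|%N => // m /= Nm.
    by have [_ _ ->] := psiP m.
split; [exact: summ|exact: summ|].
have eqm m : sum (fun j => g j * psi m (P j)) = K * sum (fun i => f i * psi m (N i)).
  have [[L [c [z [zr zE]]]] _ _] := psiP m.
  have expand (I' : choiceType) (f' : I' -> C) (N' : I' -> int) :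
      abs_summable (fun i => f' i * r ^ N' i) ->
      sum (fun i => f' i * psi m (N' i)) = \sum_k c k * sum (fun i => f' i * z k ^ N' i).
    move=> fs'; rewrite -sum_lincomb.
      congr sum; apply/funext => i; rewrite zE mulr_sumr; apply: eq_bigr => k _.
      by rewrite mulrCA.
    move=> k; apply: abs_summable_le fs' => i; rewrite !normrM.
    apply: ler_wpM2l; first exact: normr_ge0.
    by rewrite !norm_exprz zr (gtr0_norm r0).
  rewrite (expand _ _ _ gs) (expand _ _ _ fs) mulr_sumr; apply: eq_bigr => k _.
  by rewrite H// mulrCA.
apply: (cvg_unique (@norm_hausdorff C C) (lim _ _ _ gs)).
rewrite (_ : (fun m => _) = (fun m => K * sum (fun i => f i * psi m (N i)))); last first.
  by apply/funext => m; exact: eqm.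
by apply: cvgM; [exact: cvg_cst|exact: lim].
Qed.

End Transfer.

(** * The identity *)

(** Choose [k] with [r^k <= y <= r^(-k)]; then the term is at most
[r^(2t^2 - kt)] for [t = |n|], and [2t^2 - kt >= - k^2]. *)
Lemma gaussian_bound (R : realType) (r0 : R) (y : Cplx R) : 0 < r0 < 1 -> 0 < y ->
  exists B : Cplx R, forall n : int, r0%:C ^+ (2 * `|n| ^ 2) * y ^ n <= B.
Proof.
move=> r01 y0; set r : Cplx R := r0%:C; have r_gt0 : 0 < r by exact: q_gt0.
have y'0 : 0 < y^-1 by rewrite invr_gt0.
have small (t : Cplx R) : 0 < t -> exists k0 : nat, forall k, (k0 <= k)%N -> r ^+ k <= t.
  move=> t0; have /cvgrPdist_lt/(_ _ t0)[k0 _ k0P] := q_exp_cvg0 r01.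
  exists k0 => k /k0P /=; rewrite sub0r normrN ger0_norm; first exact: ltW.
  exact/exprn_ge0/ltW.
have [k1 h1] := small _ y0; have [k2 h2] := small _ y'0.
pose k := (k1 + k2)%N.
have hy : r ^+ k <= y by apply: h1; rewrite leq_addr.
have hy' : r ^+ k <= y^-1 by apply: h2; rewrite leq_addl.
have rk0 m : 0 < r ^+ m by rewrite exprn_gt0.
have key (t : nat) (u : Cplx R) : 0 < u -> r ^+ k <= u^-1 -> r ^+ (2 * t ^ 2) * u ^+ t <= r ^- (k ^ 2).
  move=> u0 ku; have uk : u <= r ^- k by rewrite -[u]invrK lef_pV2 ?posrE ?invr_gt0.
  have ut : u ^+ t <= r ^- (k * t).
    by rewrite exprM -[_^-1]exprVn lerXn2r// nnegrE ltW// invr_gt0.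
  apply: le_trans (ler_wpM2l (ltW (rk0 _)) ut) _.
  rewrite ler_pdivrMr// [leRHS]mulrC ler_pdivlMr// -exprD.
  apply: ler_wiXn2l; [exact: ltW|exact: ltW (q_lt1 r01)|clear; nia].
exists (r ^- (k ^ 2)) => -[m|m].
  by apply: key => //; rewrite -exprnP.
by rewrite NegzE abszN absz_nat -exprnN -exprVn; apply: key; rewrite ?invrK.
Qed.

Theorem mainTheorem5 (R : realType) (q0 : R) (x a : Cplx R)
    (q : Cplx R := q0%:C)
    (lhs := fun n : int =>
       q ^ (9 * n ^+ 2) * x ^ (3 * n) / (1 - a ^+ 3 * q ^ (3 * n)))
    (rhs := fun m : int * int * int => let: (j, k, l) := m in
       rho ^ (k + 2 * l) * q ^ ((j + k + l) ^+ 2) * x ^ (j + k + l) /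
       ((1 - a * q ^ j) * (1 - a * q ^ k) * (1 - a * q ^ l))) :
  0 < q0 < 1 -> x != 0 -> a != 0 ->
  (forall k : int, a ^+ 3 != q ^ (3 * k)) ->
  [/\ unconditionally_summable lhs,
      unconditionally_summable rhs &
      sum lhs =
        qpoch (q ^+ 3) (q ^+ 3) ^+ 2 / qpoch q q ^+ 6 *
        (qpochs [:: a; q / a] q ^+ 3 /
         qpochs [:: a ^+ 3; q ^+ 3 * a ^- 3] (q ^+ 3)) *
        sum rhs].
Proof.
move=> q01 x0 a0 a3.
(* The circle of radius [sqrt q] lies in the annulus [q < |z| < 1], and its image
   under cubing has the same position with respect to [q^3]. *)
pose r0 := Num.sqrt q0; pose r : Cplx R := r0%:C.
have q_pos : 0 < q0 by case/andP: q01.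
have r01 : 0 < r0 < 1.
  rewrite sqrtr_gt0 q_pos -sqrtr1 ltr_sqrt//; by case/andP: q01.
have rq : q = r ^+ 2 by rewrite -rmorphXn /= sqr_sqrtr// ltW.
have r_gt0 : 0 < r by exact: q_gt0.
have qn0 : q != 0 by rewrite rq expf_neq0// gt_eqF.
have q301 := cube_lt1 q01; have r301 := cube_lt1 r01.
have q3E : (q0 ^+ 3)%:C = q ^+ 3 by rewrite rmorphXn.
have r3E : (r0 ^+ 3)%:C = r ^+ 3 by rewrite rmorphXn.
have rq3 : (q0 ^+ 3)%:C = (r0 ^+ 3)%:C ^+ 2 by rewrite q3E r3E rq exprAC.
have q3z n : (q ^+ 3) ^ n = q ^ (3 * n) by rewrite exprnP exprz_exp.
have a1 (n : int) : a * q ^ n != 1.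
  apply: contraNneq (a3 (- n)) => h.
  have -> : a = q ^ (- n).
    by apply: (mulIf (expfz_neq0 n qn0)); rewrite h -expfzDr// addNr expr0z.
  by rewrite exprnP exprz_exp mulrC.
have a31 (n : int) : a ^+ 3 * (q0 ^+ 3)%:C ^ n != 1.
  rewrite q3E q3z; apply: contraNneq (a3 (- n)) => h; apply/eqP.
  by apply: (mulIf (expfz_neq0 (3 * n) qn0)); rewrite h -expfzDr// mulrN addNr expr0z.
have a30 : a ^+ 3 != 0 by rewrite expf_neq0.
pose w j : Cplx R := (1 - a * q ^ j)^-1.
pose T (m : int * int * int) : Cplx R :=
  rho ^ (m.1.2 + 2 * m.2) * (w m.1.1 * w m.1.2 * w m.2).
pose N (m : int * int * int) : int := m.1.1 + m.1.2 + m.2.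
pose v (n : int) : Cplx R := (1 - a ^+ 3 * q ^ (3 * n))^-1.
pose P (n : int) : int := 3 * n.
pose F (z : Cplx R) (j : int) : Cplx R := z ^ j / (1 - a * q ^ j).
have rho0 := @rho_neq0 R.
have TF (z : Cplx R) : z != 0 -> (fun m => T m * z ^ N m) =
    (fun m => F z m.1.1 * F (rho * z) m.1.2 * F (rho ^+ 2 * z) m.2).
  move=> z0; apply/funext => -[[j k] l]; rewrite /T /N /F /w /=.
  rewrite !expfzDr// (_ : rho ^ (2 * l) = (rho ^+ 2) ^ l); last by rewrite exprnP exprz_exp.
  rewrite (expfzMl rho z k) (expfzMl (rho ^+ 2) z l).
  by move: (_^-1) (_^-1) (_^-1) => A B D; ring.
have rhoz (z : Cplx R) m : `|rho ^+ m * z| = `|z| by rewrite normrM normrX norm_rho expr1n mul1r.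
have Fs (z : Cplx R) : `|z| = r -> abs_summable (F z).
  exact: (kernel_summable q01 r01 rq a z a0 a1).
have rz (z : Cplx R) : `|z| = r -> z != 0 by move=> zr; rewrite -normr_eq0 zr gt_eqF.
have rr : `|r| = r by rewrite gtr0_norm.
have rhor (z : Cplx R) : `|z| = r -> `|rho * z| = r by move=> zr; rewrite -[rho]expr1 rhoz.
have rho2r (z : Cplx R) : `|z| = r -> `|rho ^+ 2 * z| = r by move=> zr; rewrite rhoz.
have Ts (z : Cplx R) : `|z| = r -> abs_summable (fun m => T m * z ^ N m).
  move=> zr; rewrite TF ?rz//.
  apply: (abs_summable_prod (f := fun p => F z p.1 * F (rho * z) p.2)); last by apply/Fs/rho2r.
  by apply: abs_summable_prod; [exact: Fs|apply/Fs/rhor].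
have vE (z : Cplx R) : (fun n => v n * z ^ P n) =
    (fun n : int => (z ^+ 3) ^ n / (1 - a ^+ 3 * (q0 ^+ 3)%:C ^ n)).
  by apply/funext => n; rewrite /v /P q3E q3z [z ^+ 3]exprnP exprz_exp mulrC.
have r3 (z : Cplx R) : `|z| = r -> `|z ^+ 3| = (r0 ^+ 3)%:C by move=> zr; rewrite normrX zr r3E.
have vs (z : Cplx R) : `|z| = r -> abs_summable (fun n => v n * z ^ P n).
  by move=> zr; rewrite vE; exact: (kernel_summable q301 r301 rq3 _ _ a30 a31 (r3 _ zr)).
pose K := qpoch (q ^+ 3) (q ^+ 3) ^+ 2 / qpoch q q ^+ 6 * (theta q a ^+ 3 / theta (q ^+ 3) (a ^+ 3)).
have ta0 : theta q a != 0 := theta_neq0 q01 a a0 a1.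
have qq0 : qpoch q q != 0.
  by apply: (qpoch_neq0 q01) => j; rewrite -exprS eq_sym -subr_eq0 q_exp_neq1.
have H (z : Cplx R) : `|z| = r ->
    sum (fun n => v n * z ^ P n) = K * sum (fun m => T m * z ^ N m).
  move=> zr; have z0 := rz z zr.
  rewrite vE (kronecker q301 r301 rq3 _ _ a30 a31 (r3 _ zr)) TF//.
  rewrite (sum_prod (f := fun p => F z p.1 * F (rho * z) p.2)); last 2 first.
  - by apply: abs_summable_prod; [exact: Fs|apply/Fs/rhor].
  - by apply/Fs/rho2r.
  rewrite sum_prod; last 2 first.
  - exact: Fs.
  - by apply/Fs/rhor.
  rewrite !(kronecker q01 r01 rq a _ a0 a1) ?rho2r ?rhor// q3E -exprMn.
  rewrite -(theta_cube q01 z0) -(theta_cube q01 (mulf_neq0 a0 z0)) /K.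
  rewrite [a * (rho * z)]mulrCA [a * (rho ^+ 2 * z)]mulrCA.
  have t0 : theta q z != 0 := theta_neq0 q01 z z0 (circle_neq1 q01 r01 rq z zr).
  have t1 : theta q (rho * z) != 0.
    by apply: (theta_neq0 q01); [rewrite mulf_neq0|apply: (circle_neq1 q01 r01 rq); exact: rhor].
  have t2 : theta q (rho ^+ 2 * z) != 0.
    by apply: (theta_neq0 q01); [rewrite mulf_neq0 ?expf_neq0|apply: (circle_neq1 q01 r01 rq); exact: rho2r].
  have t3 : theta (q ^+ 3) (a ^+ 3) != 0.
    by rewrite -q3E; apply: (theta_neq0 q301).
  rewrite -/q.
  move: (theta q z) (theta q (rho * z)) (theta q (rho ^+ 2 * z)) (theta (q ^+ 3) _) (theta q a)
    (qpoch q q) (theta q (a * z)) (theta q (rho * (a * z))) (theta q (rho ^+ 2 * (a * z)))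
    (qpoch _ _) t0 t1 t2 t3 ta0 qq0 => s1 s2 s3 s4 s5 s6 s7 s8 s9 s10 h1 h2 h3 h4 h5 h6.
  by field; rewrite h1 h2 h3 h4 h5 h6.
(* Since [q^(9n^2) x^(3n) = phi (3n)], the same weight serves both sides. *)
pose phi (n : int) : Cplx R := q ^ (n ^+ 2) * x ^ n.
have [B phiB] : exists B : Cplx R, forall n, `|phi n| <= B * r ^ n.
  have y0 : 0 < `|x| / r by rewrite divr_gt0// normr_gt0.
  have [B hB] := gaussian_bound r01 y0; exists B => n.
  rewrite -ler_pdivrMr ?exprz_gt0//; apply: le_trans (hB n).
  rewrite /phi; have -> : n ^+ 2 = (`|n|%N ^ 2)%N%:Z by rewrite -[LHS]gez0_abs ?sqr_ge0// abszX.
  rewrite normrM !norm_exprz -exprnP rq normrX rr -/r (exprM r 2) expfzMl exprz_inv -invr_expz.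
  by rewrite mulrA.
have [Tphi vphi E] := weighted_sum_transfer r_gt0 (Ts r rr) (vs r rr) H phiB.
have lhsE : lhs = (fun n => v n * phi (P n)).
  apply/funext => n; rewrite /lhs /phi /P mulrC; congr (_ * (q ^ _ * _)); ring.
have rhsE : rhs = (fun m => T m * phi (N m)).
  apply/funext => -[[j k] l]; rewrite /rhs /T /phi /N /w /= !invfM.
  by move: (_^-1) (_^-1) (_^-1) => A B' D; ring.
rewrite lhsE rhsE; split; [exact: abs_summable_cvg|exact: abs_summable_cvg|exact: E].
Qed.
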